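(* Let $\mathbb{K}$ be a field of arbitrary characteristic, $n$ a positive integer and $R=\mathbb{K}[x_1,\dots,x_n]$. Let $\mathcal{D}_n$ be the Betti cone generated by all Betti diagrams of Stanley-Reisner ideals in $R$. Then $$\dim \mathcal{D}_n=\frac{n(n+1)}{2}.$$
   Context: $R$ is standard graded. For a finitely generated graded $R$-module $M$ with minimal graded free resolution $0\to\bigoplus_{d\in\mathbb{Z}}R(-d)^{\beta_{p,d}}\to\dots\to\bigoplus_{d\in\mathbb{Z}} R(-d)^{\beta_{0,d}}\to M\to0$, the Betti diagram of $M$ is $\beta(M)=(\beta_{i,d})_{0\le i\le n,\,d\in\mathbb{Z}}$, viewed as a vector in the rational vector space $\bigoplus_{d\in\mathbb{Z}}\mathbb{Q}^{n+1}$. The Betti diagram of an ideal $I$ of $R$ is the diagram of $I$ itself as an $R$-module (not of $R/I$), so $\beta_{0,d}(I)$ counts minimal generators of degree $d$. A simplicial complex $\Delta$ on $[n]=\{1,\dots,n\}$ is a set of subsets of $[n]$ closed under taking subsets (not every singleton need be a face). Its Stanley-Reisner ideal is $I_\Delta=\langle \prod_{i\in\sigma}x_i : \sigma\subseteq[n],\ \sigma\notin\Delta\rangle$, a squarefree monomial ideal of $R$. The Betti cone generated by a set of diagrams is the convex cone in $\bigoplus_{d\in\mathbb{Z}}\mathbb{Q}^{n+1}$ generated by the positive rational rays spanned by these diagrams; its dimension is the dimension of the smallest $\mathbb{Q}$-linear subspace containing it.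
   Formalization: The empty set is required to be a face of every simplicial complex; this excludes only the void complex, whose Stanley-Reisner ideal is R itself, with which the dimension would be one larger (2 instead of 1 for n = 1). *)

(* Defs.v *)
From HB Require Import structures.
From mathcomp Require Import all_boot all_order all_algebra.
From mathcomp Require monalg.
From mathcomp Require Import mpoly.

Set Implicit Arguments.
Unset Strict Implicit.
Unset Printing Implicit Defensive.

Import GRing.Theory.
Local Open Scope ring_scope.

(* mpoly.dhomog is indexed by nat, whereas shifts are integers: a homogeneous
   polynomial of negative degree is 0. *)
Definition homogeneous_int (n : nat) (K : fieldType) (d : int)
    (p : {mpoly K[n]}) : Prop :=
  match d with
  | Posz k => p \is k.-homog
  | Negz _ => p = 0
  end.

(* A finite sequence of graded free modules over R = K[x_1..x_n] with an
   augmentation to R: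
     ... -> F_(i+1) -> F_i -> ... -> F_0 -> R.
   F_i is R^(rk i), written as row vectors, and its a-th basis vector has degree
   [shift i a], i.e. F_i is the direct sum of the R(- shift i a).
   Maps act by right multiplication: F_(i+1) -> F_i is u |-> u *m diff i. *)
Record free_seq (n : nat) (K : fieldType) := FreeSeq {
  rk : nat -> nat;
  shift : forall i, 'I_(rk i) -> int;
  diff : forall i, 'M[{mpoly K[n]}]_(rk i.+1, rk i);
  aug : 'cV[{mpoly K[n]}]_(rk 0)
}.

Section Resolution.
Variables (n : nat) (K : fieldType).
Implicit Type F : free_seq n K.

Definition finite_length F : Prop := exists p, forall i, (p < i)%N -> rk F i = 0%N.

Definition graded F : Prop :=
  (forall a, homogeneous_int (shift a) (aug F a 0))
  /\ (forall i a b, homogeneous_int (shift a - shift b) (diff F i a b)).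

(* The augmentation maps F_0 onto the ideal I, so that this is the exactness of
   0 -> F_p -> ... -> F_0 -> I -> 0. *)
Definition exact_onto F (I : {mpoly K[n]} -> Prop) : Prop :=
  [/\ forall f, I f <-> exists u : 'rV_(rk F 0), (u *m aug F) 0 0 = f,
      forall u : 'rV_(rk F 0),
        u *m aug F = 0 <-> exists v, u = v *m diff F 0
    & forall i (u : 'rV_(rk F i.+1)),
        u *m diff F i = 0 <-> exists v, u = v *m diff F i.+1].

(* The image of F_(i+1) lies in <x_1, ..., x_n> F_i: the entries of the
   differentials have no constant term. *)
Definition minimal F : Prop := forall i a b, (diff F i a b)@_0%MM = 0.

Definition minimal_graded_free_resolution (I : {mpoly K[n]} -> Prop) F : Prop :=
  [/\ finite_length F, graded F, exact_onto F I & minimal F].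

Definition betti F (i : nat) (d : int) : nat := #|[set a : 'I_(rk F i) | shift a == d]|.

End Resolution.

(* monalg and mpoly notations clash, hence the local import. *)
Section DiagramSpace.
Import monalg.
Variable n : nat.

(* Finitely supported families (beta_(i,d)) with 0 <= i <= n and d an integer,
   i.e. the direct sum of copies of Q^(n+1) indexed by d. *)
Definition diagram_space : lmodType rat := {malg rat[('I_n.+1 * int)%type]}.

Definition diagram_coeff (beta : diagram_space) (i : 'I_n.+1) (d : int) : rat :=
  mcoeff (i, d) beta.

End DiagramSpace.

Definition is_betti_diagram (n : nat) (K : fieldType) (I : {mpoly K[n]} -> Prop)
    (beta : diagram_space n) : Prop :=
  exists2 F : free_seq n K, minimal_graded_free_resolution I F
    & forall i d, diagram_coeff beta i d = (betti F i d)%:R.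

(* The empty set is a face of every simplicial complex; this excludes only the
   void complex, whose Stanley-Reisner ideal would be the unit ideal. *)
Definition simplicial_complex (n : nat) (D : {set {set 'I_n}}) : Prop :=
  set0 \in D /\ forall s t : {set 'I_n}, t \subset s -> s \in D -> t \in D.

Definition stanley_reisner (n : nat) (K : fieldType) (D : {set {set 'I_n}})
    (f : {mpoly K[n]}) : Prop :=
  exists c : {set 'I_n} -> {mpoly K[n]},
    f = \sum_(s | s \notin D) c s * \prod_(i in s) 'X_i.

Section Cone.
Variable V : lmodType rat.
Implicit Types S W : V -> Prop.

Definition cone S (v : V) : Prop :=
  exists (k : nat) (c : 'I_k -> rat) (s : 'I_k -> V),
    (forall j, 0 <= c j /\ S (s j)) /\ v = \sum_j c j *: s j.

Definition subspace W : Prop :=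
  W 0 /\ forall (a : rat) u v, W u -> W v -> W (a *: u + v).

Definition smallest_subspace S (v : V) : Prop :=
  forall W, subspace W -> (forall u, S u -> W u) -> W v.

Definition is_basis W (m : nat) (b : 'I_m -> V) : Prop :=
  [/\ forall j, W (b j),
      forall c : 'I_m -> rat, \sum_j c j *: b j = 0 -> forall j, c j = 0
    & forall w, W w -> exists c : 'I_m -> rat, w = \sum_j c j *: b j].

Definition has_dimension W (m : nat) : Prop :=
  exists b : 'I_m -> V, is_basis W b.

Definition cone_has_dimension S (m : nat) : Prop :=
  has_dimension (smallest_subspace S) m.

End Cone.

Definition sr_betti_cone (n : nat) (K : fieldType) : diagram_space n -> Prop :=
  cone (fun beta : diagram_space n =>
    exists2 D : {set {set 'I_n}}, simplicial_complex D
      & is_betti_diagram (@stanley_reisner n K D) beta).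

(* Main.v *)
(** For a Stanley-Reisner ideal, beta_(i,d) vanishes unless i < d <= n, which leaves
    n(n+1)/2 entries.  The bound i < d holds because the entries of a minimal
    resolution have no constant term.  For d <= n, iterated mapping cones along
    the generators (the colon ideal by a squarefree monomial x_s is a squarefree
    monomial ideal in the variables outside s) give a resolution, usually not
    minimal, all of whose shifts are at most n; comparing it with a minimal one
    shows that the shifts of the latter occur among its shifts.

    Conversely, for a set B of b variables and k+1 further variables x_a, the ideal
    x_B * (x_a : a) is resolved by a Koszul complex: its resolution is
    (b+1)-linear of length exactly k.  These diagrams are triangular with respect
    to the unit vectors of the entries i < d <= n, which they therefore span. *)
Require Import Defs.
From mathcomp Require Import all_boot all_algebra.
From mathcomp Require Import order mpoly zify.
From mathcomp Require monalg.
From Stdlib Require Import IndefiniteDescription.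

Set Implicit Arguments.
Unset Strict Implicit.
Unset Printing Implicit Defensive.

Import Order.TTheory GRing.Theory Num.Theory.
Local Open Scope ring_scope.

(** * Homogeneous components *)

Section Polynomials.
Variables (n : nat) (K : fieldType).
Implicit Types (p q f g : {mpoly K[n]}) (m : 'X_{1..n}) (d e : int).

Lemma mcoeff_sum_neq0 (I : finType) (P : pred I) (F : I -> {mpoly K[n]}) m :
  (\sum_(i | P i) F i)@_m != 0 -> exists2 i, P i & (F i)@_m != 0.
Proof.
rewrite raddf_sum /= => nz; apply/exists_inP; apply: contraNT nz => /exists_inPn z.
by apply/eqP/big1 => i /z /negPn /eqP.
Qed.

Lemma mcoeffM_neq0 p q m :
  (p * q)@_m != 0 -> exists m1 m2, [/\ m = (m1 + m2)%MM, p@_m1 != 0 & q@_m2 != 0].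
Proof.
rewrite -mcoeff_msupp => /msuppM_le /allpairsP [[m1 m2] /= [s1 s2 ->]].
by exists m1, m2; rewrite -!mcoeff_msupp.
Qed.

Lemma mcoeff0M p q : (p * q)@_0%MM = p@_0%MM * q@_0%MM.
Proof. exact: rmorphM (mcoeff 0%MM) p q. Qed.

(** Serves two purposes: a test on the degree extracts homogeneous components, and a test on
    divisibility splits an element of a monomial ideal along a generator. *)
Definition mfilter (P : pred 'X_{1..n}) p : {mpoly K[n]} :=
  \sum_(m <- msupp p | P m) p@_m *: 'X_[m].

Lemma mcoeff_mfilter P p m : (mfilter P p)@_m = if P m then p@_m else 0.
Proof.
rewrite /mfilter raddf_sum /= big_mkcond /=.
case: (boolP (m \in msupp p)) => mp.
  rewrite (bigD1_seq m) //= big1 => [|k /negPf km]; last first.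
    by rewrite mcoeffZ mcoeffX km mulr0 if_same.
  by rewrite mcoeffZ mcoeffX eqxx mulr1 addr0.
rewrite big_seq big1 ?memN_msupp_eq0 // ?if_same // => k kp.
rewrite mcoeffZ mcoeffX; case: eqP => [km|]; last by rewrite mulr0 if_same.
by rewrite km (negPf mp) in kp.
Qed.

Lemma mfilterC P p : mfilter P p + mfilter (predC P) p = p.
Proof.
apply/mpolyP => m; rewrite mcoeffD !mcoeff_mfilter /=.
by case: (P m); rewrite ?addr0 ?add0r.
Qed.

Lemma mfilterD P : {morph mfilter P : p q / p + q}.
Proof.
move=> p q; apply/mpolyP => m; rewrite mcoeffD !mcoeff_mfilter mcoeffD.
by case: (P m); rewrite ?addr0.
Qed.

Lemma mfilter0 P : mfilter P 0 = 0.
Proof. by apply/mpolyP => m; rewrite mcoeff_mfilter mcoeff0 if_same. Qed.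

(** Treats both signs of [d] at once: no monomial has negative degree, so for negative [d] the
    condition on the support forces [p = 0]. *)
Lemma homogeneous_intP d p :
  homogeneous_int d p <-> forall m, p@_m != 0 -> (mdeg m)%:Z = d.
Proof.
case: d => k /=; split.
- by move/dhomogP => h m; rewrite -mcoeff_msupp => /h ->.
- by move=> h; apply/dhomogP => m; rewrite mcoeff_msupp => /h [].
- by move=> -> m; rewrite mcoeff0 eqxx.
- move=> h; apply/mpolyP => m; rewrite mcoeff0; apply/eqP.
  by apply: contraT => /h.
Qed.

Lemma homogeneous_int0 d : homogeneous_int d (0 : {mpoly K[n]}).
Proof. by apply/homogeneous_intP => m; rewrite mcoeff0 eqxx. Qed.

Lemma homogeneous_intN d p : homogeneous_int d p -> homogeneous_int d (- p).
Proof.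
by move/homogeneous_intP => h; apply/homogeneous_intP => m; rewrite mcoeffN oppr_eq0 => /h.
Qed.

Lemma homogeneous_intM d e p q :
  homogeneous_int d p -> homogeneous_int e q -> homogeneous_int (d + e) (p * q).
Proof.
move=> /homogeneous_intP hp /homogeneous_intP hq; apply/homogeneous_intP => m.
by move=> /mcoeffM_neq0 [m1 [m2 [-> /hp <- /hq <-]]]; rewrite mdegD.
Qed.

Lemma homogeneous_int_sum d (I : finType) (F : I -> {mpoly K[n]}) :
  (forall i, homogeneous_int d (F i)) -> homogeneous_int d (\sum_i F i).
Proof.
move=> h; apply/homogeneous_intP => m /mcoeff_sum_neq0 [i _].
by move/homogeneous_intP: (h i); apply.
Qed.

Lemma homogeneous_int_const d p : homogeneous_int d p -> p@_0%MM != 0 -> d = 0.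
Proof. by move/homogeneous_intP => h /h <-; rewrite mdeg0. Qed.

Lemma homogeneous_int_gt0 d p :
  homogeneous_int d p -> p != 0 -> p@_0%MM = 0 -> 0 < d.
Proof.
move=> /homogeneous_intP h p0 c0; have := mlead_supp p0; rewrite mcoeff_msupp => lp.
rewrite -(h _ lp) ltz_nat lt0n mdeg_eq0.
by apply: contra_neq lp => ->.
Qed.

Definition hcomp d p : {mpoly K[n]} := mfilter (fun m => (mdeg m)%:Z == d) p.

Lemma hcomp_homogeneous d p : homogeneous_int d (hcomp d p).
Proof.
apply/homogeneous_intP => m; rewrite mcoeff_mfilter /=.
by case: (_ =P d) => // _; rewrite eqxx.
Qed.

Lemma hcomp_id d p : homogeneous_int d p -> hcomp d p = p.
Proof.
move/homogeneous_intP => h; apply/mpolyP => m; rewrite mcoeff_mfilter /=.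
by case: (eqVneq p@_m 0) => [->|/h ->]; rewrite ?if_same ?eqxx.
Qed.

Lemma hcomp_eq0 d e p : homogeneous_int e p -> d != e -> hcomp d p = 0.
Proof.
move/homogeneous_intP => h de; apply/mpolyP => m; rewrite mcoeff_mfilter mcoeff0 /=.
case: (eqVneq p@_m 0) => [->|/h ->]; rewrite ?if_same //.
by rewrite eq_sym (negPf de).
Qed.

Lemma hcomp_sum d (I : Type) (r : seq I) (F : I -> {mpoly K[n]}) :
  hcomp d (\sum_(i <- r) F i) = \sum_(i <- r) hcomp d (F i).
Proof. by apply: (big_morph (hcomp d)); [apply: mfilterD | apply: mfilter0]. Qed.

Lemma hcompM d e p q : homogeneous_int e q -> hcomp (d + e) (p * q) = hcomp d p * q.
Proof.
move=> hq.
rewrite [in LHS](mpolyE p) [in RHS](mpolyE p) mulr_suml !hcomp_sum mulr_suml.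
apply: eq_bigr => m _.
have hm : homogeneous_int (mdeg m)%:Z (p@_m *: 'X_[m]).
  apply/homogeneous_intP => k; rewrite mcoeffZ mcoeffX.
  by case: (m =P k) => [->//|_]; rewrite mulr0 eqxx.
case: (eqVneq d (mdeg m)%:Z) => [->|ne].
  by rewrite !hcomp_id //; apply: homogeneous_intM.
rewrite (hcomp_eq0 hm) // mul0r (hcomp_eq0 (homogeneous_intM hm hq)) //.
by rewrite (inj_eq (addIr e)).
Qed.

End Polynomials.

(** * Augmented complexes and chain maps *)

Section Complexes.
Variables (n : nat) (K : fieldType).
Local Notation P := {mpoly K[n]}.
Implicit Types F H : free_seq n K.

Definition graded_mx m r (s : 'I_m -> int) (t : 'I_r -> int) (A : 'M[P]_(m, r)) :=
  forall a b, homogeneous_int (s a - t b) (A a b).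

Lemma graded_mxM m r k (s : 'I_m -> int) (t : 'I_r -> int) (z : 'I_k -> int)
    (A : 'M[P]_(m, r)) (B : 'M[P]_(r, k)) :
  graded_mx s t A -> graded_mx t z B -> graded_mx s z (A *m B).
Proof.
move=> gA gB a b; rewrite mxE; apply: homogeneous_int_sum => c.
have -> : s a - z b = (s a - t c) + (t c - z b) by lia.
exact: homogeneous_intM.
Qed.

Lemma lift_rows m r k (A : 'M[P]_(m, r)) (D : 'M[P]_(k, r)) :
  (forall a, exists v : 'rV_k, row a A = v *m D) -> exists B, A = B *m D.
Proof.
move=> /fin_all_exists [f hf]; exists (\matrix_a f a).
by apply/row_matrixP => a; rewrite row_mul rowK.
Qed.

(** Any lift can be made graded: as [D] is homogeneous, replacing each entry of the lift by its
    component of the expected degree does not change the product with [D]. *)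
Lemma graded_lift_rows m r k (s : 'I_m -> int) (t : 'I_r -> int) (z : 'I_k -> int)
    (A : 'M[P]_(m, r)) (D : 'M[P]_(k, r)) :
    graded_mx s t A -> graded_mx z t D ->
    (forall a, exists v : 'rV_k, row a A = v *m D) ->
  exists2 B, B *m D = A & graded_mx s z B.
Proof.
move=> gA gD /lift_rows [B defA].
exists (\matrix_(a, b) hcomp (s a - z b) (B a b)); last first.
  by move=> a b; rewrite mxE; apply: hcomp_homogeneous.
apply/matrixP => a b; rewrite -(hcomp_id (gA a b)) defA !mxE.
rewrite hcomp_sum; apply: eq_bigr => c _.
rewrite mxE -(hcompM (s a - z c) (B a c) (gD c b)).
by congr hcomp; lia.
Qed.

(* The complex augmented by R in position 0: position [i.+1] holds F_i. *)
Definition ark F i : nat := if i is j.+1 then rk F j else 1.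

Definition ashift F i : 'I_(ark F i) -> int :=
  if i is j.+1 return 'I_(ark F i) -> int then fun a => shift a else fun=> 0.

Definition adiff F i : 'M[P]_(ark F i.+1, ark F i) :=
  if i is j.+1 return 'M[P]_(ark F i.+1, ark F i) then diff F j else aug F.

Definition in_aug_image F (f : P) := exists u : 'rV_(rk F 0), (u *m aug F) 0 0 = f.

Definition exact_aug F :=
  forall i (u : 'rV_(ark F i.+1)), u *m adiff F i = 0 <-> exists v, u = v *m adiff F i.+1.

Lemma exact_ontoP F I :
  exact_onto F I <-> (forall f, I f <-> in_aug_image F f) /\ exact_aug F.
Proof.
split=> [[hI h0 hS]|[hI hF]]; first by split=> // -[|i] u; [exact: h0 | exact: hS].
by split=> // [u|i u]; [exact: (hF 0%N u) | exact: (hF i.+1 u)].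
Qed.

Lemma gradedP F :
  graded F <-> forall i, graded_mx (@ashift F i.+1) (@ashift F i) (adiff F i).
Proof.
split=> [[h0 hS] [|i] a b|h].
- by rewrite [b]ord1 subr0; exact: h0.
- exact: hS.
split=> [a|i a b]; last exact: (h i.+1).
by have := h 0%N a 0; rewrite subr0.
Qed.

Lemma exact_adiffM F i : exact_aug F -> adiff F i.+1 *m adiff F i = 0.
Proof.
move=> exF; apply/row_matrixP => a; rewrite row_mul row0; apply/exF.
by exists (delta_mx 0 a); rewrite -rowE.
Qed.

(** Comparison theorem for multiplication by [c] on R, of degree [w]: each composite of [phi i] with
    the differential of [H] lands in the cycles of [F], which are boundaries, so it lifts to the
    next position. *)
Lemma chain_map_exists H F (w : int) (c : P) :
    (forall i, adiff H i.+1 *m adiff H i = 0) -> graded H ->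
    exact_aug F -> graded F -> homogeneous_int w c ->
    (forall a, in_aug_image F (aug H a 0 * c)) ->
  exists phi : forall i, 'M[P]_(ark H i, ark F i),
    [/\ phi 0%N = c%:M, forall i, phi i.+1 *m adiff F i = adiff H i *m phi i
      & forall i, graded_mx (fun a => @ashift H i a + w) (@ashift F i) (phi i)].
Proof.
move=> dH /gradedP gH exF /gradedP gF hc him.
(* The second clause says that the next lift exists; it is the invariant that keeps the recursion
   going. *)
pose good i (X : 'M[P]_(ark H i, ark F i)) :=
  graded_mx (fun a => @ashift H i a + w) (@ashift F i) X /\
  forall a, exists v, row a (adiff H i *m X) = v *m adiff F i.
have good0 : good 0%N (c%:M : 'M_(ark H 0, ark F 0)).
  split=> [a b|a]; first by rewrite !ord1 mxE subr0 add0r eqxx.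
  have [u hu] := him a; exists u; apply/matrixP => i j.
  by rewrite !ord1 hu row_mul mul_mx_scalar !mxE mulrC.
have goodS i (X : {X | good i X}) :
    {Y | good i.+1 Y /\ Y *m adiff F i = adiff H i *m sval X}.
  (* The maps form a family defined by recursion on [i], each depending on the previous one, so
     existence has to be turned into data. *)
  apply: constructive_indefinite_description.
  case: X => X [gX /= liftX].
  have gHX : graded_mx (fun a => @ashift H i.+1 a + w) (@ashift F i) (adiff H i *m X).
    apply: graded_mxM gX => a b.
    by have -> : @ashift H i.+1 a + w - (@ashift H i b + w) = @ashift H i.+1 a - @ashift H i b;
      [lia | apply: gH].
  have [Y defY gY] := graded_lift_rows gHX (gF i) liftX.
  exists Y; split=> //; split=> // a; apply/exF.
  by rewrite -row_mul -mulmxA defY mulmxA dH mul0mx row0.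
pose phi := nat_rect (fun i => {X | good i X}) (exist _ _ good0)
  (fun i X => exist _ (sval (goodS i X)) (proj1 (svalP (goodS i X)))).
exists (fun i => sval (phi i)); split=> // i; last by case: (phi i) => X [].
by rewrite /=; case: (goodS i _) => Y [].
Qed.

End Complexes.

(** * Mapping cones *)

Section MappingCone.
Variables (n : nat) (K : fieldType).
Local Notation P := {mpoly K[n]}.

(** Diagram chase for one degree of the cone: once [u2] is the boundary of [w], correcting [u1] by
    the image of [w] gives a cycle for [a], hence a boundary [z *m b]. *)
Lemma mapping_cone_exact_step r2 r1 r0 s1 s0 (b : 'M[P]_(r2, r1)) (a : 'M[P]_(r1, r0))
    (h : 'M[P]_(s1, s0)) (phi1 : 'M[P]_(s1, r1)) (phi0 : 'M[P]_(s0, r0))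
    (u1 : 'rV_r1) (u2 : 'rV_s0) (w : 'rV_s1) :
    phi1 *m a = h *m phi0 -> (forall u : 'rV_r1, u *m a = 0 -> exists z, u = z *m b) ->
    u1 *m a + u2 *m phi0 = 0 -> u2 = w *m h ->
  exists v, row_mx u1 u2 = v *m block_mx b 0 phi1 (- h).
Proof.
move=> chain exb u0 defu2.
have [|z hz] := exb (u1 + w *m phi1).
  by rewrite mulmxDl -mulmxA chain mulmxA -defu2.
exists (row_mx z (- w)).
by rewrite mul_row_block -hz mulmx0 add0r mulNmx mulmxN mulNmx opprK addrK -defu2.
Qed.

Variables (F H : free_seq n K) (w : int) (c : P).
Variable phi : forall i, 'M[P]_(ark H i, ark F i).

(** The cone of [phi] from H(-w) to F. Position 0 of [H], which is R itself, becomes the new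
    generator [c] in homological degree 0, so position [i] of [H] joins F_i. The sign makes
    consecutive differentials compose to zero. *)
Definition mapping_cone : free_seq n K := {|
  rk i := rk F i + ark H i;
  shift i a := match split a with inl b => shift b | inr b => ashift b + w end;
  diff i := block_mx (diff F i) 0 (phi i.+1) (- adiff H i);
  aug := col_mx (aug F) (phi 0) |}.

Hypothesis phi0 : phi 0%N = c%:M.
Hypothesis phiS : forall i, phi i.+1 *m adiff F i = adiff H i *m phi i.

Lemma mapping_cone_graded :
    graded F -> graded H ->
    (forall i, graded_mx (fun a => @ashift _ _ H i a + w) (@ashift _ _ F i) (phi i)) ->
  graded mapping_cone.
Proof.
move=> [gF0 gF] /gradedP gH gphi; split=> [a|i a b] /=.
  rewrite mxE; case: (split a) => a'; first exact: gF0.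
  by have := gphi 0%N a' 0; rewrite subr0.
rewrite /block_mx !mxE; case: (split a) => a'; rewrite mxE; case: (split b) => b'.
- exact: gF.
- by rewrite mxE; apply: homogeneous_int0.
- exact: (gphi i.+1).
- rewrite mxE; apply: homogeneous_intN.
  have -> : @ashift _ _ H i.+1 a' + w - (ashift b' + w) = @ashift _ _ H i.+1 a' - ashift b'.
    by lia.
  exact: gH.
Qed.

Hypotheses (exF : exact_aug F) (exH : exact_aug H).

(** In the lowest degree, the coefficient of the new generator in a syzygy lies in the colon ideal
    of the image of [F] by [c], which by hypothesis lies in the image of [H]. In higher degrees
    exactness of [H] takes over. *)
Lemma mapping_cone_exact :
  (forall f, in_aug_image F (f * c) -> in_aug_image H f) -> exact_aug mapping_cone.
Proof.
move=> colon i u; split=> [|[v ->]]; last first.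
  rewrite -mulmxA; case: i u v => [|i] u v /=.
    rewrite mul_block_col mul0mx addr0 (exact_adiffM 0 exF) (phiS 0) mulNmx subrr.
    by rewrite col_mx0 mulmx0.
  rewrite mulmx_block !mul0mx !mulmx0 !addr0 add0r (exact_adiffM i.+1 exF) (phiS i.+1).
  rewrite !mulNmx mulmxN opprK subrr (exact_adiffM i exH).
  by rewrite block_mx0 mulmx0.
case: i u => [|i] /= u; rewrite -[u]hsubmxK.
  rewrite mul_row_col => u0.
  have [|w0 hw0] := colon (rsubmx u 0 0).
    exists (- lsubmx u); rewrite mulNmx; move/eqP: u0; rewrite addr_eq0 => /eqP ->.
    by rewrite opprK phi0 mul_mx_scalar mxE mulrC.
  have {}hw0 : rsubmx u = w0 *m adiff H 0 by apply/matrixP => x y; rewrite !ord1 -hw0.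
  exact: (mapping_cone_exact_step (phiS 0) (fun u => (@exF 0 u).1) u0 hw0).
rewrite mul_row_block mulmx0 add0r mulmxN => /eqP.
rewrite row_mx_eq0 => /andP[/eqP u0]; rewrite oppr_eq0 => /eqP /exH [w0 hw0].
exact: (mapping_cone_exact_step (phiS i.+1) (fun u => (@exF i.+1 u).1) u0 hw0).
Qed.

Lemma mapping_cone_image f :
  in_aug_image mapping_cone f <-> exists g h, in_aug_image F g /\ f = g + h * c.
Proof.
split=> [[u <-]|[g [h [[u <-] ->]]]].
  rewrite -[u]hsubmxK /= mul_row_col phi0 mul_mx_scalar mxE [X in _ + X]mxE mulrC.
  exists (((lsubmx u) *m aug F) 0 0), (rsubmx u 0 0).
  by split; first by exists (lsubmx u).
exists (row_mx u h%:M) => /=.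
by rewrite mul_row_col phi0 mul_mx_scalar mxE [X in _ + X]mxE [h%:M _ _]mxE mulrC.
Qed.

End MappingCone.

(** * Squarefree monomial ideals *)

Section MonomialIdeals.
Variables (n : nat) (K : fieldType).
Local Notation P := {mpoly K[n]}.
Implicit Types (s t V : {set 'I_n}) (gs : seq {set 'I_n}) (m : 'X_{1..n}) (f g h : P).

Definition sqf s : 'X_{1..n} := [multinom (i \in s : nat) | i < n].

Lemma sqf_leP s m : reflect (forall i, i \in s -> (0 < m i)%N) (sqf s <= m)%MM.
Proof.
apply: (iffP mnm_lepP) => h i; last by rewrite mnmE; case: (boolP (i \in s)) => // /h.
by move=> si; have := h i; rewrite mnmE si.
Qed.

Lemma mdeg_sqf s : mdeg (sqf s) = #|s|.
Proof.
rewrite mdegE -sum1_card [RHS]big_mkcond; apply: eq_bigr => i _.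
by rewrite mnmE; case: (i \in s).
Qed.

Lemma mpolyX_sqf s : 'X_[sqf s] = \prod_(i in s) 'X_i :> P.
Proof.
have -> : sqf s = (\sum_(i in s) U_(i))%MM.
  apply/mnmP => j; rewrite mnm_sumE mnmE big_mkcond (bigD1 j) //= big1 => [|i /negPf ij].
    by rewrite mnm1E eqxx addn0; case: (j \in s).
  by rewrite mnm1E ij if_same.
exact: (big_morph (fun m => 'X_[m] : P) (@mpolyXD n K) (@mpolyX0 n K)).
Qed.

Lemma mcoeffMX_neq0 f m0 m : (f * 'X_[m0])@_m != 0 -> (m0 <= m)%MM /\ f@_(m - m0) != 0.
Proof.
move=> /mcoeffM_neq0 [m1 [m2 [-> f1]]]; rewrite mcoeffX.
by case: (m0 =P m2) => [<- _|_]; last rewrite eqxx //; rewrite lem_addl addmK.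
Qed.

Lemma mpolyX_divides m0 f :
  (forall m, f@_m != 0 -> (m0 <= m)%MM) -> exists g, f = g * 'X_[m0].
Proof.
move=> h; exists (\sum_(m <- msupp f) f@_m *: 'X_[m - m0]).
rewrite mulr_suml [LHS]mpolyE !big_seq; apply: eq_bigr => m.
by rewrite mcoeff_msupp -scalerAl -mpolyXD => /h /submK ->.
Qed.

Lemma homogeneous_int_sqf s : homogeneous_int #|s|%:Z ('X_[sqf s] : P).
Proof.
apply/homogeneous_intP => m; rewrite mcoeffX.
by case: (sqf s =P m) => [<-|_]; rewrite ?mdeg_sqf ?eqxx.
Qed.

(** The ideal generated by the monomials ['X_[sqf s]] with [s] in [gs]: membership in a monomial
    ideal can be tested on each monomial of the support. *)
Definition mideal gs f : Prop := forall m, f@_m != 0 -> has (fun s => (sqf s <= m)%MM) gs.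

Lemma mideal0 gs : mideal gs 0.
Proof. by move=> m; rewrite mcoeff0 eqxx. Qed.

Lemma mideal_nil f : mideal [::] f <-> f = 0.
Proof.
split=> [h|->]; last exact: mideal0.
by apply/mpolyP => m; rewrite mcoeff0; apply/eqP; apply: contraT => /h.
Qed.

Lemma mideal_cons s gs f :
  mideal (s :: gs) f <-> exists g h, mideal gs g /\ f = g + h * 'X_[sqf s].
Proof.
split=> [hf|[g [h [hg ->]]] m].
  (* The monomials divisible by an older generator go into [g]; all others must be divisible by the
     new one. *)
  pose Q m := has (fun t => (sqf t <= m)%MM) gs.
  have [|h hh] := @mpolyX_divides (sqf s) (mfilter (predC Q) f).
    move=> m; rewrite mcoeff_mfilter /= /Q.
    by case: ifP => [/negPf q /hf /=|]; [rewrite q orbF | rewrite eqxx].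
  exists (mfilter Q f), h; rewrite -hh mfilterC; split=> // m.
  by rewrite mcoeff_mfilter; case: ifP => //; rewrite eqxx.
rewrite mcoeffD /=; case: (eqVneq g@_m 0) => [->|/hg ->]; last by rewrite orbT.
by rewrite add0r => /mcoeffMX_neq0 [-> _].
Qed.

(** The monomial of [t] divides m times the monomial of [s] exactly when that of [t :\: s] divides
    m. *)
Lemma mideal_colon s gs f :
  mideal gs (f * 'X_[sqf s]) <-> mideal [seq t :\: s | t <- gs] f.
Proof.
split=> hf m.
  rewrite -(mcoeffMX f (sqf s)) => /hf; rewrite has_map; apply: sub_has => t /=.
  move=> /sqf_leP h; apply/sqf_leP => i /setDP [it /negPf si].
  by have := h i it; rewrite mnmDE mnmE si.
move=> /mcoeffMX_neq0 [/sqf_leP sm /hf]; rewrite has_map; apply: sub_has => t /=.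
move=> /sqf_leP h; apply/sqf_leP => i it; case: (boolP (i \in s)) => [/sm //|si].
by have := h i; rewrite inE si it mnmBE => /(_ isT); lia.
Qed.

Lemma stanley_reisnerP (D : {set {set 'I_n}}) f :
  @stanley_reisner n K D f <-> mideal (enum (~: D)) f.
Proof.
split=> [[c ->] m /mcoeff_sum_neq0 [s sD]|hf].
  rewrite -mpolyX_sqf => /mcoeffMX_neq0 [sm _]; apply/hasP; exists s => //.
  by rewrite mem_enum inE.
rewrite [f]mpolyE big_seq; apply: (big_ind (@stanley_reisner n K D)).
- by exists (fun=> 0); rewrite big1 // => s _; rewrite mul0r.
- move=> _ _ [c ->] [c' ->]; exists (fun s => c s + c' s).
  by rewrite -big_split; apply: eq_bigr => s _; rewrite mulrDl.
- move=> m; rewrite mcoeff_msupp => /hf /hasP [s]; rewrite mem_enum inE => sD sm.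
  exists (fun t => if t == s then f@_m *: 'X_[m - sqf s] else 0).
  rewrite (bigD1 s) //= eqxx -mpolyX_sqf big1 => [|t /andP[_ /negPf ->]]; last by rewrite mul0r.
  by rewrite addr0 -scalerAl -mpolyXD submK.
Qed.

(** * Resolutions by iterated mapping cones *)

Definition zero_seq : free_seq n K := {|
  rk := fun=> 0%N; shift := fun _ _ => 0; diff := fun=> 0; aug := 0 |}.

Lemma zero_seq_resolution :
  [/\ graded zero_seq, exact_aug zero_seq
    & forall f, in_aug_image zero_seq f <-> mideal [::] f].
Proof.
split; first by split=> [[]|i []].
  move=> i u; split=> _; last by case: i u => [|i] u; rewrite /= mulmx0.
  by exists 0; apply/matrixP => a [].
move=> f; rewrite mideal_nil; split=> [[u <-]|->]; first by rewrite mulmx0 mxE.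
by exists 0; rewrite mulmx0 mxE.
Qed.

Lemma mapping_cone_mideal (F H : free_seq n K) s gs w
    (phi : forall i, 'M[P]_(ark H i, ark F i)) :
    (forall f, in_aug_image F f <-> mideal gs f) ->
    phi 0%N = 'X_[sqf s]%:M ->
  forall f, in_aug_image (@mapping_cone n K F H w phi) f <-> mideal (s :: gs) f.
Proof.
move=> imF phi0 f; rewrite mideal_cons (mapping_cone_image _ phi0).
by split=> -[g [h [/imF]]] ig ->; exists g, h.
Qed.

(** The colon ideal by [s] lives on the variables of [V :\: s], so after the twist by the degree of
    [s] its shifts are at most #|V :\: s| + #|s| = #|V|. *)
Lemma bounded_resolution gs V :
    all (fun s : {set 'I_n} => s \subset V) gs ->
  exists F : free_seq n K, [/\ graded F, exact_aug F, forall f, in_aug_image F f <-> mideal gs f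
    & forall i (a : 'I_(ark F i)), ashift a <= #|V|%:Z].
Proof.
(* Induction on the length, with [gs] and [V] general: the colon ideal has a different list of
   generators, of the same length as the tail. *)
have [k] := ubnP (size gs); elim: k => // k IH in gs V *; case: gs => [|s gs] /=.
  move=> _ _; have [gZ eZ iZ] := zero_seq_resolution.
  by exists zero_seq; split=> // -[|i] [].
rewrite ltnS => szgs /andP[sV gsV].
have [F [gF exF imF shF]] := IH gs V szgs gsV.
have [||H [gH exH imH shH]] := IH [seq t :\: s | t <- gs] (V :\: s).
- by rewrite size_map.
- by rewrite all_map; apply: sub_all gsV => t tV; apply: setSD.
have [||phi [phi0 phiS gphi]] :=
  @chain_map_exists n K H F #|s|%:Z 'X_[sqf s] _ gH exF gF (homogeneous_int_sqf s).
- by move=> i; apply: exact_adiffM.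
- move=> a; apply/imF/mideal_colon/imH; exists (delta_mx 0 a).
  by rewrite -rowE mxE.
exists (mapping_cone #|s|%:Z phi); split.
- exact: mapping_cone_graded.
- by refine (mapping_cone_exact phi0 phiS exF exH _) => f /imF /mideal_colon /imH.
- exact: mapping_cone_mideal.
case=> [|i] a /=; first by [].
case: (split a) => b; first exact: (shF i.+1).
have := shH i b; rewrite cardsDS //; have := subset_leq_card sV.
by move=> su; rewrite -subzn // lerBrDr.
Qed.

(** The Koszul complex: a variable outside [A] is a nonzerodivisor modulo those of [A], so the colon
    ideal is the old ideal and the cone is taken over multiplication by the new variable on [F]
    itself. *)
Lemma linear_resolution (A : seq 'I_n) : uniq A ->
  exists F : free_seq n K, [/\ graded F, exact_aug F,
    forall f, in_aug_image F f <-> mideal [seq [set a] | a <- A] f,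
    forall i (a : 'I_(ark F i)), ashift a = i%:Z
    & (0 < ark F (size A))%N /\ forall i, (size A < i)%N -> ark F i = 0%N].
Proof.
elim: A => [_|y A IH] /=.
  have [gZ eZ iZ] := zero_seq_resolution.
  by exists zero_seq; split=> //; [case=> [|i] [] | split=> // -[]].
move=> /andP[yA /IH [F [gF exF imF shF [rk1 rk0]]]].
pose phi i : 'M[P]_(ark F i, ark F i) := 'X_[sqf [set y]]%:M.
have phiS i : phi i.+1 *m adiff F i = adiff F i *m phi i.
  by rewrite mul_scalar_mx mul_mx_scalar.
exists (@mapping_cone n K F F 1 phi); split.
- apply: mapping_cone_graded => // i a b; rewrite mxE !shF.
  case: (a == b); last exact: homogeneous_int0.
  apply/homogeneous_intP => m; rewrite mulr1n mcoeffX.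
  by case: (sqf [set y] =P m) => [<- _|_]; [rewrite mdeg_sqf cards1; lia | rewrite eqxx].
- refine (mapping_cone_exact (erefl (phi 0)) phiS exF exF _) => f.
  move=> /imF /mideal_colon h; apply/imF.
  suff <- : [seq t :\: [set y] | t <- [seq [set a] | a <- A]] = [seq [set a] | a <- A] by [].
  rewrite -map_comp; apply/eq_in_map => a aA /=; apply/setDidPl.
  by rewrite disjoints1 inE; apply: contraNneq yA => <-.
- exact: mapping_cone_mideal.
(* Position [i] of the second copy enters position [i.+1] of the cone, and the twist by 1 raises its
   shifts accordingly. *)
- case=> [|i] a //=; case: (split a) => b; first by rewrite -(shF i.+1 b).
  by rewrite shF; lia.
split=> [|[//|i]]; first by rewrite /= addn_gt0 rk1 orbT.
by move=> iA; have /= -> := rk0 i.+1 (ltnW iA); rewrite rk0.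
Qed.

End MonomialIdeals.

(** * Shifts of minimal resolutions *)

Section MinimalShifts.
Variables (n : nat) (K : fieldType).
Local Notation P := {mpoly K[n]}.

Lemma mcoeff0_mulmx m r k (A : 'M[P]_(m, r)) (B : 'M[P]_(r, k)) a b :
  ((A *m B) a b)@_0%MM = \sum_c (A a c)@_0%MM * (B c b)@_0%MM.
Proof. by rewrite mxE raddf_sum; apply: eq_bigr => c _; apply: mcoeff0M. Qed.

Variable F : free_seq n K.
Hypotheses (exF : exact_aug F) (gF : graded F).
Hypothesis minF : forall i a b, (adiff F i a b)@_0%MM = 0.

(** Shifts grow strictly along the complex. A zero row would make a basis vector a cycle, hence a
    boundary, but boundaries have no constant terms; and a nonzero entry without constant term has
    positive degree. *)
Lemma minimal_shift_ge i (a : 'I_(ark F i)) : i%:Z <= ashift a.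
Proof.
elim: i a => [|i IH] a //.
have /existsP [b nz] : [exists b, adiff F i a b != 0].
  apply: contraT; rewrite negb_exists => /forallP z.
  have /exF [v hv] : delta_mx 0 a *m adiff F i = 0 :> 'rV_(ark F i).
    by rewrite -rowE; apply/rowP => b; rewrite !mxE; apply/eqP/negPn/z.
  have := congr1 (fun u : 'rV_(ark F i.+1) => (u 0 a)@_0%MM) hv.
  rewrite mcoeff0_mulmx mxE !eqxx mcoeff1 eqxx big1 => [/eqP|c _].
    by rewrite oner_eq0.
  by rewrite minF mulr0.
have /gradedP g := gF.
have := homogeneous_int_gt0 (g i a b) nz (minF a b); have := IH b.
by rewrite subr_gt0 => le lt; apply: le_lt_trans le lt.
Qed.

(* The chain endomorphism [F -> T -> F] is homotopic to the identity, hence equals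
   it modulo the variables since F is minimal; a basis vector of F of degree [d]
   therefore has an invertible coefficient on one of T, of the same degree. *)
Lemma minimal_shift_le (T : free_seq n K) (N : int) :
    exact_aug T -> graded T -> (forall f, in_aug_image F f <-> in_aug_image T f) ->
    (forall i (a : 'I_(ark T i)), ashift a <= N) ->
  forall i (a : 'I_(ark F i.+1)), ashift a <= N.
Proof.
move=> exT gT imFT shT.
have him (G : free_seq n K) a : in_aug_image G (aug G a 0 * 1).
  by exists (delta_mx 0 a); rewrite -rowE mxE mulr1.
have h1 : homogeneous_int 0 (1 : P).
  by apply/homogeneous_intP => m; rewrite mcoeff1; case: (m =P 0%MM) => [->|_]; rewrite ?mdeg0 ?eqxx.
have [f [f0 fS gf]] := chain_map_exists (fun i => exact_adiffM i exF) gF exT gT h1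
  (fun a => (imFT _).1 (him F a)).
have [g [g0 gS gg]] := chain_map_exists (fun i => exact_adiffM i exT) gT exF gF h1
  (fun a => (imFT _).2 (him T a)).
pose psi i := f i *m g i - 1%:M.
have psi0 : psi 0%N = 0 by rewrite /psi f0 g0 mulmx1 subrr.
have psiS i : psi i.+1 *m adiff F i = adiff F i *m psi i.
  by rewrite mulmxBl mulmxBr mul1mx mulmx1 -mulmxA gS !mulmxA fS.
have homotopyS i (s : 'M_(ark F i, ark F i.+1)) :
    adiff F i *m (psi i - s *m adiff F i) = 0 ->
    exists s', psi i.+1 - adiff F i *m s = s' *m adiff F i.+1.
  move=> hs; apply: lift_rows => a; apply/exF.
  by rewrite -row_mul mulmxBl psiS -mulmxA -mulmxBr hs row0.
(* This consequence of the homotopy formula suffices to build the next [s], so existence at each [i]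
   separately is enough and no coherent family of homotopies has to be chosen. *)
have homotopy i : exists s : 'M_(ark F i, ark F i.+1),
    adiff F i *m (psi i - s *m adiff F i) = 0.
  elim: i => [|i [s /homotopyS [s' hs']]].
    by exists 0; rewrite mul0mx subr0 psi0 mulmx0.
  exists s'; rewrite -hs' opprB addrC subrK mulmxA.
  by rewrite (exact_adiffM i exF) mul0mx.
move=> i a.
have psi_const : (psi i.+1 a a)@_0%MM = 0.
  have [s /homotopyS [s' /eqP]] := homotopy i.
  (* Each of the two summands of the homotopy formula has a differential of [F] as a factor, so its
     constant term vanishes. *)
  rewrite subr_eq => /eqP ->; rewrite mxE mcoeffD !mcoeff0_mulmx.
  by rewrite !big1 ?addr0 // => c _; rewrite minF ?mulr0 ?mul0r.
have fg1 : ((f i.+1 *m g i.+1) a a)@_0%MM = 1.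
  have -> : f i.+1 *m g i.+1 = psi i.+1 + 1%:M by rewrite subrK.
  by rewrite mxE mcoeffD psi_const add0r mxE eqxx mcoeff1 eqxx.
have /existsP [c hc] : [exists c, (f i.+1 a c)@_0%MM != 0].
  apply: contraT; rewrite negb_exists => /forallP z.
  move: fg1; rewrite mcoeff0_mulmx big1 => [/esym/eqP|c _]; first by rewrite oner_eq0.
  by rewrite (eqP (negPn (z c))) mul0r.
have := homogeneous_int_const (gf i.+1 a c) hc.
by move/eqP; rewrite addr0 subr_eq0 => /eqP ->; apply: shT.
Qed.

End MinimalShifts.

(** * Support of the Betti diagrams of Stanley-Reisner ideals *)

Section BettiSupport.
Variables (n : nat) (K : fieldType).

Lemma betti_stanley_reisner_support (D : {set {set 'I_n}}) (F : free_seq n K) i d :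
    set0 \in D -> minimal_graded_free_resolution (stanley_reisner D) F ->
    betti F i d != 0%N ->
  (i%:Z < d) && (d <= n%:Z).
Proof.
move=> D0 [_ gF /exact_ontoP [imF exF] mF]; rewrite cards_eq0 => /set0Pn [a].
rewrite inE => /eqP <-.
(* Minimality covers the differentials only. For the augmentation, a generator with a constant term
   would make the empty set a nonface. *)
have minF j b c : (adiff F j b c)@_0%MM = 0.
  case: j b c => [|j] b c; last exact: mF.
  rewrite [c]ord1; apply/eqP; apply: contraT => nz.
  have /imF/stanley_reisnerP/(_ _ nz)/hasP [s] : in_aug_image F (aug F b 0).
    by exists (delta_mx 0 b); rewrite -rowE mxE.
  rewrite mem_enum inE => sD /sqf_leP le0; suff s0 : s = set0 by rewrite s0 D0 in sD.
  by apply/setP => j; rewrite inE; apply/negP => /le0; rewrite mnm0E.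
have [|T [gT exT imT shT]] := @bounded_resolution n K (enum (~: D)) [set: 'I_n].
  by apply/allP => s _; apply: subsetT.
apply/andP; split.
  (* F_i sits in position [i.+1], which makes the inequality [i < d] strict. *)
  by have := minimal_shift_ge exF gF minF (i := i.+1) a; rewrite /=; lia.
rewrite cardsT card_ord in shT.
have imFT f : in_aug_image F f <-> in_aug_image T f by rewrite imT -stanley_reisnerP imF.
exact: (minimal_shift_le exF gF minF exT gT imFT shT (a : 'I_(ark F i.+1))).
Qed.

End BettiSupport.

(** * Ideals with linear resolution *)

Section LinearIdeals.
Variables (n : nat) (K : fieldType).
Local Notation P := {mpoly K[n]}.

(** Turns a resolution of I into one of pI: multiplication by a nonzero [p] of degree [w] is an
    isomorphism of I(-w) onto pI. *)
Definition twist (F : free_seq n K) (p : P) (w : int) : free_seq n K := {|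
  rk := rk F; shift i a := shift a + w; diff := diff F; aug := p *: aug F |}.

Lemma twist_image F p w f :
  in_aug_image (twist F p w) f <-> exists2 g, in_aug_image F g & f = g * p.
Proof.
split=> [[u <-]|[_ [u <-] ->]].
  by exists ((u *m aug F) 0 0); [exists u | rewrite /= -scalemxAr mxE mulrC].
by exists u; rewrite /= -scalemxAr mxE mulrC.
Qed.

Lemma twist_exact F p w : p != 0 -> exact_aug F -> exact_aug (twist F p w).
Proof.
move=> p0 exF [|i] u; last exact: (exF i.+1).
rewrite -(exF 0%N) -scalemxAr; split=> [/matrixP h|->]; last by rewrite scaler0.
apply/matrixP => a b; have e := h a b; rewrite [LHS]mxE [RHS]mxE in e.
by move/eqP: e; rewrite mulf_eq0 (negPf p0) [RHS]mxE => /eqP.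
Qed.

Lemma twist_graded F p w : homogeneous_int w p -> graded F -> graded (twist F p w).
Proof.
move=> hp [g0 gS]; split=> [a|i a b] /=; last by rewrite opprD addrACA subrr addr0.
by rewrite mxE addrC; apply: homogeneous_intM.
Qed.

(** The nonfaces are the sets that contain [B] and meet [A]; for [A] disjoint from [B] the
    Stanley-Reisner ideal is x_B times the ideal of the variables in [A]. *)
Definition linear_complex (B : {set 'I_n}) (A : seq 'I_n) : {set {set 'I_n}} :=
  [set s : {set 'I_n} | ~~ ((B \subset s) && has (mem s) A)].

Lemma linear_complex_simplicial B A : simplicial_complex (linear_complex B A).
Proof.
split=> [|s t ts]; rewrite !inE.
  by apply/negP => /andP[_ /hasP [a _]] /=; rewrite in_set0.
apply: contra => /andP[Bt /hasP [a aA ta]]; rewrite (subset_trans Bt ts).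
by apply/hasP; exists a => //; apply: (subsetP ts).
Qed.

Lemma stanley_reisner_linear (B : {set 'I_n}) (A : seq 'I_n) f : all (fun a => a \notin B) A ->
  @stanley_reisner n K (linear_complex B A) f <->
  exists2 g, mideal [seq [set a] | a <- A] g & f = g * 'X_[sqf B].
Proof.
move=> /allP AB; rewrite stanley_reisnerP; split=> [hf|[g hg ->] m].
  have {}hf m : f@_m != 0 -> (sqf B <= m)%MM /\ exists2 a, a \in A & (0 < m a)%N.
    move=> /hf /hasP [s]; rewrite mem_enum !inE negbK => /andP[Bs /hasP [a aA sa]] /sqf_leP sm.
    split; last by exists a => //; apply: sm.
    by apply/sqf_leP => i /(subsetP Bs); apply: sm.
  have [m /hf []//|g defg] := @mpolyX_divides _ _ (sqf B) f.
  exists g => // m; rewrite -(mcoeffMX g (sqf B)) -defg => /hf [_ [a aA]].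
  (* Disjointness enters here: division by x_B leaves the exponent of [a] unchanged. *)
  rewrite mnmDE mnmE (negPf (AB a aA)) add0n => ma.
  apply/hasP; exists [set a]; first exact: map_f.
  by apply/sqf_leP => i /set1P ->.
move=> /mcoeffMX_neq0 [/sqf_leP Bm /hg /hasP [_ /mapP [a aA ->]] /sqf_leP am].
apply/hasP; exists (a |: B).
  rewrite mem_enum !inE negbK subsetU1; apply/hasP; exists a => //.
  exact: setU11.
apply/sqf_leP => i /setU1P [->|/Bm //].
by have := am a (set11 a); rewrite mnmBE; lia.
Qed.

Lemma linear_betti (B : {set 'I_n}) (A : seq 'I_n) k :
    uniq A -> all (fun a => a \notin B) A -> size A = k.+1 ->
  exists F : free_seq n K,
    [/\ minimal_graded_free_resolution (stanley_reisner (linear_complex B A)) F,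
      forall i d, betti F i d = if d == (i + #|B|).+1%:Z then rk F i else 0%N,
      (0 < rk F k)%N & forall i, (k < i)%N -> rk F i = 0%N].
Proof.
move=> uA AB szA; have [F [gF exF imF shF [rk1 rk0]]] := linear_resolution K uA.
rewrite szA in rk1 rk0.
have shF' i (a : 'I_(rk F i)) : shift a = i.+1%:Z by rewrite -(shF i.+1 a).
have XB0 : 'X_[sqf B] != 0 :> P.
  apply/eqP => /(congr1 (mcoeff (sqf B))); rewrite mcoeffX mcoeff0 eqxx.
  by move/eqP; rewrite oner_eq0.
exists (twist F 'X_[sqf B] #|B|%:Z); split=> //; last by move=> i; apply: (rk0 i.+1).
  split; first by exists k => i; apply: (rk0 i.+1).
  - exact: twist_graded (homogeneous_int_sqf K B) gF.
  - apply/exact_ontoP; split; last exact: twist_exact.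
    move=> f; rewrite stanley_reisner_linear // twist_image.
    by split=> -[g /imF ig ->]; exists g.
  (* Consecutive shifts differ by 1, so the entries are linear forms and have no constant term. *)
  - move=> i a b; apply/eqP; apply: contraT => /= nz.
    have [_ gS] := gF; have := homogeneous_int_const (gS i a b) nz.
    by rewrite !shF'; lia.
move=> i d; rewrite /betti /=; case: eqP => [->|ne].
  rewrite (_ : [set _ | _] = setT) ?cardsT ?card_ord //.
  by apply/setP => a; rewrite !inE shF' -PoszD addSn eqxx.
apply/eqP; rewrite cards_eq0; apply/eqP/setP => a; rewrite !inE shF'.
by apply/eqP => e; apply: ne; rewrite -e -PoszD addSn.
Qed.

Lemma disjoint_enum b k : (b + k < n)%N ->
  exists (B : {set 'I_n}) (A : seq 'I_n),
    [/\ #|B| = b, uniq A, all (fun a => a \notin B) A & size A = k.+1].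
Proof.
move=> bk; exists [set x in take b (enum 'I_n)], (take k.+1 (drop b (enum 'I_n))).
have := enum_uniq 'I_n; rewrite -{1}(cat_take_drop b (enum 'I_n)) cat_uniq.
move=> /and3P[uB /hasPn dis uA]; split.
- by rewrite cardsE (card_uniqP uB) size_takel // size_enum_ord; lia.
- exact: take_uniq.
- by apply/allP => a /mem_take /dis; rewrite inE.
- by rewrite size_takel // size_drop size_enum_ord; lia.
Qed.

End LinearIdeals.

(** * The span of the diagrams *)

Section Subspaces.
Variable V : lmodType rat.
Implicit Types W S : V -> Prop.

Lemma smallest_subspaceP S : subspace (smallest_subspace S).
Proof.
split=> [W [W0 _] //|a u v hu hv W sW SW].
by have [_ WD] := sW; apply: WD; [apply: hu | apply: hv].
Qed.

Lemma smallest_subspace_sub S v : S v -> smallest_subspace S v.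
Proof. by move=> Sv W _; apply. Qed.

Lemma subspaceZ W a v : subspace W -> W v -> W (a *: v).
Proof. by case=> W0 WD Wv; rewrite -[_ *: _]addr0; apply: WD. Qed.

Lemma subspaceD W u v : subspace W -> W u -> W v -> W (u + v).
Proof. by case=> _ WD Wu Wv; rewrite -[u]scale1r; apply: WD. Qed.

Lemma subspace_sum W (I : finType) (P : pred I) (F : I -> V) :
  subspace W -> (forall i, P i -> W (F i)) -> W (\sum_(i | P i) F i).
Proof.
by move=> sW WF; apply: (big_ind W) => //; [case: sW | move=> *; apply: subspaceD].
Qed.

Lemma cone_sub S v : S v -> cone S v.
Proof.
move=> Sv; exists 1%N, (fun=> 1), (fun=> v); split=> //.
by rewrite big_ord1 scale1r.
Qed.

Lemma subspace_cone W S v : subspace W -> (forall u, S u -> W u) -> cone S v -> W v.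
Proof.
move=> sW SW [k [c [s [h ->]]]]; apply: subspace_sum => // j _.
by apply: subspaceZ => //; apply: SW; have [] := h j.
Qed.

End Subspaces.

(** * Diagrams supported in the triangle *)

Section Diagrams.
Variable n : nat.
Implicit Types (v : diagram_space n) (i : 'I_n.+1) (d : int).

Definition diagram_unit i d : diagram_space n := monalg.mkmalgU (i, d) (1 : rat).

Lemma diagram_coeff0 i d : diagram_coeff (0 : diagram_space n) i d = 0.
Proof. exact: monalg.mcoeff0. Qed.

Lemma diagram_coeffD u v i d :
  diagram_coeff (u + v) i d = diagram_coeff u i d + diagram_coeff v i d.
Proof. exact: monalg.mcoeffD. Qed.

Lemma diagram_coeffZ a v i d : diagram_coeff (a *: v) i d = a * diagram_coeff v i d.
Proof. exact: monalg.mcoeffZ. Qed.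

Lemma diagram_coeff_sum (I : finType) (P : pred I) (F : I -> diagram_space n) i d :
  diagram_coeff (\sum_(j | P j) F j) i d = \sum_(j | P j) diagram_coeff (F j) i d.
Proof.
apply: (big_morph (fun v => diagram_coeff v i d)); last exact: diagram_coeff0.
by move=> u v; apply: diagram_coeffD.
Qed.

Lemma diagram_coeff_unit j e i d :
  diagram_coeff (diagram_unit j e) i d = ((j, e) == (i, d))%:R.
Proof. exact: monalg.mcoeffU. Qed.

Lemma diagramP u v : (forall i d, diagram_coeff u i d = diagram_coeff v i d) -> u = v.
Proof. by move=> h; apply/monalg.malgP => -[i d]; apply: h. Qed.

Definition supported v : Prop :=
  forall i d, diagram_coeff v i d != 0 -> (i%:Z < d) && (d <= n%:Z).

Lemma supported_subspace : subspace supported.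
Proof.
split=> [i d|a u v su sv i d]; first by rewrite diagram_coeff0 eqxx.
rewrite diagram_coeffD diagram_coeffZ.
have [u0|/su //] := eqVneq (diagram_coeff u i d) 0.
by rewrite u0 mulr0 add0r; apply: sv.
Qed.

(** The pair (i, t) stands for the entry (i, d) with d = t + 1, so that i < d <= n becomes i <= t <
    n. *)
Definition triangle : {set 'I_n * 'I_n} :=
  [set p : 'I_n * 'I_n | (p.1 <= p.2)%N].

(** Counted by the second coordinate t, which leaves t + 1 choices for the first. *)
Lemma card_triangle : #|triangle| = ((n * (n + 1)) %/ 2)%N.
Proof.
have -> : #|triangle| = \sum_(t < n) t.+1.
  rewrite cardsE -sum1_card -(pair_big_dep xpredT (fun i t : 'I_n => i <= t)%N (fun _ _ => 1%N)).
  rewrite (exchange_big_dep xpredT) //=; apply: eq_bigr => t _.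
  by rewrite -(big_ord_widen n (fun=> 1%N) (ltn_ord t)) sum_nat_const card_ord muln1.
suff -> : (n * (n + 1) = 2 * \sum_(t < n) t.+1)%N by rewrite mulKn.
by elim: (n) => [|m IH]; rewrite ?big_ord0 // big_ord_recr /= [RHS]mulnDr -IH; lia.
Qed.

Definition triangle_unit (p : 'I_n * 'I_n) : diagram_space n :=
  diagram_unit (widen_ord (leqnSn n) p.1) (p.2).+1%:Z.

Lemma triangle_unit_coeff (p : 'I_n * 'I_n) i d :
  diagram_coeff (triangle_unit p) i d = ((p.1 == i :> nat) && ((p.2).+1%:Z == d))%:R.
Proof. by rewrite diagram_coeff_unit. Qed.

Lemma triangle_unit_free (c : 'I_#|triangle| -> rat) :
  \sum_j c j *: triangle_unit (enum_val j) = 0 -> forall j, c j = 0.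
Proof.
move=> sum0 j; pose p := enum_val j.
have := congr1 (fun v => diagram_coeff v (widen_ord (leqnSn n) p.1) (p.2).+1%:Z) sum0.
rewrite diagram_coeff0 diagram_coeff_sum (bigD1 j) //= big1 => [|k kj]; last first.
  rewrite diagram_coeffZ triangle_unit_coeff.
  case: andP => [[/eqP e1 /eqP [e2]]|]; last by rewrite mulr0.
  case/eqP: kj; apply: enum_val_inj; rewrite -/p.
  by case: (enum_val k) p e1 e2 => a b [a' b'] /= /val_inj -> /val_inj ->.
by rewrite diagram_coeffZ triangle_unit_coeff !eqxx mulr1 addr0.
Qed.

Lemma triangle_unit_span v : supported v ->
  exists c : 'I_#|triangle| -> rat, v = \sum_j c j *: triangle_unit (enum_val j).
Proof.
move=> sv; exists (fun j : 'I_#|triangle| => diagram_coeff v (widen_ord (leqnSn n) (enum_val j).1)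
                              ((enum_val j).2).+1%:Z).
apply: diagramP => i d; rewrite diagram_coeff_sum.
have [v0|] := eqVneq (diagram_coeff v i d) 0.
  rewrite v0 big1 // => j _; rewrite diagram_coeffZ triangle_unit_coeff.
  case: andP => [[/eqP e1 /eqP e2]|]; last by rewrite mulr0.
  by rewrite e2 (_ : widen_ord _ _ = i) ?v0 ?mul0r //; apply: val_inj.
move=> nz; have /andP[] := sv _ _ nz; case: d nz => [[|d]|d] // nz.
rewrite ltz_nat lez_nat ltnS => id dn.
have [j hj] : exists j : 'I_#|triangle|,
    enum_val j = (Ordinal (leq_ltn_trans id dn), Ordinal dn).
  have tp : (Ordinal (leq_ltn_trans id dn), Ordinal dn) \in triangle by rewrite inE.
  by exists (enum_rank_in tp (Ordinal (leq_ltn_trans id dn), Ordinal dn)); rewrite enum_rankK_in.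
rewrite (bigD1 j) //= hj [X in _ = X + _]diagram_coeffZ triangle_unit_coeff /= !eqxx mulr1.
rewrite big1 => [|l].
  by rewrite addr0; congr diagram_coeff; apply: val_inj.
apply: contraNeq; rewrite diagram_coeffZ triangle_unit_coeff.
case: andP => [[/eqP e1 /eqP [e2]] _|]; last by rewrite mulr0 eqxx.
apply/eqP/enum_val_inj; rewrite hj.
by case: (enum_val l) e1 e2 => a b /= e1 e2; congr pair; apply: val_inj.
Qed.

End Diagrams.

(** * The span of the cone *)

Section Dimension.
Variables (K : fieldType) (n : nat).

Lemma sr_cone_supported (v : diagram_space n) : sr_betti_cone K v -> supported v.
Proof.
apply: subspace_cone; first exact: supported_subspace.
move=> beta [D [D0 _] [F resF hF]] i d; rewrite hF => nz.
apply: (betti_stanley_reisner_support D0 resF).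
by apply: contra_neq nz => ->.
Qed.

(* The diagram of the ideal with (b+1)-linear resolution of length k gives the
   unit at (k, b+1+k) modulo the units (i, b+1+i) with i < k. *)
Lemma diagram_unit_in_span b k (i : 'I_n.+1) : (b + k < n)%N -> i = k :> nat ->
  smallest_subspace (@sr_betti_cone n K) (diagram_unit i (k + b).+1%:Z).
Proof.
have sW := smallest_subspaceP (@sr_betti_cone n K).
elim/ltn_ind: k i => k IH i bk ik.
have [B [A [cB uA AB szA]]] := disjoint_enum bk.
have [F [resF bF rk1 rk0]] := linear_betti K uA AB szA.
pose beta : diagram_space n :=
  \sum_(j < n.+1) (rk F j)%:R *: diagram_unit j (j + b).+1%:Z.
have Wbeta : smallest_subspace (@sr_betti_cone n K) beta.
  apply: smallest_subspace_sub; apply: cone_sub => /=; exists (linear_complex B A).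
    exact: linear_complex_simplicial.
  exists F => // j d; rewrite bF cB diagram_coeff_sum (bigD1 j) //= big1 => [|l /negPf lj].
    rewrite diagram_coeffZ diagram_coeff_unit xpair_eqE eqxx /= addr0 eq_sym.
    by case: eqP; rewrite ?mulr1 ?mulr0.
  by rewrite diagram_coeffZ diagram_coeff_unit xpair_eqE lj mulr0.
have rki : (rk F i)%:R != 0 :> rat by rewrite pnatr_eq0 ik -lt0n.
have -> : diagram_unit i (k + b).+1%:Z = (rk F i)%:R^-1 *: (beta
    + -1 *: \sum_(j < n.+1 | j != i) (rk F j)%:R *: diagram_unit j (j + b).+1%:Z).
  rewrite scaleN1r /beta (bigD1 i) //= addrK scalerA mulVf // scale1r ik.
  by [].
apply: (subspaceZ _ sW); apply: (subspaceD sW) => //; apply: (subspaceZ _ sW).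
(* For [j < k] the induction hypothesis applies with the same [b]; for [k < j] the rank is zero. *)
apply: (subspace_sum sW) => j ji; have [jk|kj|jk] := ltngtP j k.
- by apply: (subspaceZ _ sW); apply: IH => //; lia.
- by rewrite rk0 // scale0r; case: sW.
- by case/eqP: ji; apply: val_inj; rewrite /= jk ik.
Qed.

End Dimension.

Theorem theorem3p2 (K : fieldType) (n : nat) (hn : (0 < n)%N) :
  cone_has_dimension (@sr_betti_cone n K) ((n * (n + 1)) %/ 2)%N.
Proof.
rewrite -card_triangle; exists (fun j : 'I_#|triangle n| => triangle_unit (enum_val j)); split.
- move=> j; have := enum_valP j; rewrite inE; case: (enum_val j) => a b /= ab.
  (* The entry (a, b + 1) is the last nonzero one of the diagram of an ideal generated in degree b -
     a + 1 with linear resolution of length a. *)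
  have := @diagram_unit_in_span K n (b - a) a (widen_ord (leqnSn n) a).
  by rewrite subnK // subnKC //; apply.
- exact: triangle_unit_free.
(* The supported diagrams form a subspace containing the cone, hence contain its span. *)
- move=> w /(_ _ (supported_subspace n)) h; apply: triangle_unit_span.
  by apply: h => v; apply: sr_cone_supported.
Qed.
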